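(* Let $(X^s_*(\cdot),U^s_*(\cdot))$ be the optimal stationary pair and let $S\in\mathbb{R}^{n\times n}$, $H\in\mathbb{R}^{(n+l)\times(n+l)}$ be symmetric positive definite matrices satisfying the dissipativity identity (both as described in the context). Then for each $X_0\sim\mathcal{N}(\mu_0,\Sigma_0)$ there exists a constant $C\in\mathbb{R}$ such that for each $\delta>0$, each $N\in\mathbb{N}$, each control process $U(\cdot)$ satisfying $$J_N(X_0,U)\le \delta+\sum_{k=0}^{N-1}\ell(X^s_*(k),U^s_*(k)),$$ and each $\varepsilon>0$, the value $$Q_\varepsilon:=\#\Big\{k\in\{0,\ldots,N-1\}\;\Big|\;\mathbb{E}\Big[\big\|(X(k)-X^s_*(k),\,U(k)-U^s_*(k))\big\|_H^2\Big]\le\varepsilon\Big\},$$ where $X(\cdot)=X_U(\cdot,X_0)$, satisfies $$Q_\varepsilon\ge N-\frac{\delta+C}{\varepsilon}.$$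
   Context: Setting. Let $A\in\mathbb{R}^{n\times n}$, $B\in\mathbb{R}^{n\times l}$ with $(A,B)$ stabilizable; $R\in\mathbb{R}^{l\times l}$ symmetric positive definite; $Q\in\mathbb{R}^{n\times n}$ symmetric positive semidefinite with $(A,Q^{1/2})$ detectable. On a probability space $(\Omega,\mathcal{F},\mathbb{P})$ consider $$X(k+1)=AX(k)+BU(k)+W(k),\quad X(0)=X_0,\qquad k\in\mathbb{N}_0,$$ where $W(k)\sim\mathcal{N}(0,\Sigma_W)$ are i.i.d. $\mathbb{R}^n$-valued Gaussian random variables with zero mean and covariance $\Sigma_W$, and $X_0\sim\mathcal{N}(\mu_0,\Sigma_0)$. A control process is a sequence $U(\cdot)$ with $U(k)\in L^2(\Omega,\mathcal{F}_k,\mathbb{P},\mathbb{R}^l)$, where $\mathcal{F}_k=\sigma(X(0),\ldots,X(k))$ is the filtration generated by the corresponding state process; also $X(k)\in L^2(\Omega,\mathcal{F}_k,\mathbb{P},\mathbb{R}^n)$. It is a standing assumption that for every state and control process under consideration $W(k)$ is independent of $(X(k),U(k))$ for all $k$ (this also applies to the stationary pair $(X^s_*(\cdot),U^s_*(\cdot))$). The solution is denoted $X_U(\cdot,X_0)$, or $X(\cdot)$ for short. Notation: $\|x\|_M^2:=x^TMx$ for a symmetric positive semidefinite matrix $M$; $(x,u)$ is the stacked vector in $\mathbb{R}^{n+l}$. Stage cost: $\ell(X,U):=\mathbb{E}[\|X\|_Q^2+\|U\|_R^2]$. Cost: $J_N(X_0,U):=\sum_{k=0}^{N-1}\ell(X(k),U(k))$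 with $X(\cdot)=X_U(\cdot,X_0)$. Let $P$ be the unique positive semidefinite solution of $P=A^TPA+Q-A^TPB[R+B^TPB]^{-1}B^TPA$ and $K:=-[R+B^TPB]^{-1}B^TPA$ (so $A+BK$ is Schur-stable). Optimal stationary pair: $U^s_*(k)=KX^s_*(k)$, $X^s_*(k+1)=(A+BK)X^s_*(k)+W(k)$ (with the same noise process $W(\cdot)$ that drives the system $X(k+1)=AX(k)+BU(k)+W(k)$), $X^s_*(0)\sim\mathcal{N}(0,\Sigma^s_* )$, where $\Sigma^s_*$ is the solution of $\Sigma^s_*=(A+BK)\Sigma^s_*(A+BK)^T+\Sigma_W$; thus $X^s_*(k)\sim\mathcal{N}(0,\Sigma^s_* )$ for all $k$. Dissipativity identity: the symmetric positive definite matrices $S$ and $H$ are such that for every control process $U(\cdot)$ with state $X(\cdot)$ and every $k\in\mathbb{N}_0$, $$\ell(X(k),U(k))-\ell(X^s_*(k),U^s_*(k))+\tilde\lambda(k,X(k))-\tilde\lambda(k+1,X(k+1))=\mathbb{E}\big[\|(X(k)-X^s_*(k),U(k)-U^s_*(k))\|_H^2\big],$$ where $\tilde\lambda(k,X(k)):=-\mathbb{E}\big[\|X(k)\|_P^2-\|X(k)-X^s_*(k)\|_P^2\big]+\mathbb{E}\big[\|X(k)-X^s_*(k)\|_S^2\big]$. Such matrices exist. *)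

(* Defs.v *)
From HB Require Import structures.
From mathcomp Require Import all_boot all_order all_algebra.
From mathcomp Require Import complex.
From mathcomp Require Import all_classical all_reals all_analysis.

Set Implicit Arguments.
Unset Strict Implicit.
Unset Printing Implicit Defensive.

Import Order.TTheory GRing.Theory Num.Theory.
Import numFieldNormedType.Exports.

Local Open Scope classical_set_scope.
Local Open Scope ring_scope.

Section linear_algebra.
Context {R : realType}.

Definition qform {n : nat} (M : 'M[R]_n) (x : 'cV[R]_n) : R :=
  (x^T *m M *m x) 0 0.

Definition psd {n : nat} (M : 'M[R]_n) : Prop :=
  M^T = M /\ forall x : 'cV[R]_n, 0 <= qform M x.

Definition posdef {n : nat} (M : 'M[R]_n) : Prop :=
  M^T = M /\ forall x : 'cV[R]_n, x != 0 -> 0 < qform M x.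

Definition schur_stable {n : nat} (M : 'M[R]_n) : Prop :=
  forall z : R[i], eigenvalue (map_mx (real_complex R) M) z -> `|z| < 1.

Definition stabilizable {n l : nat} (A : 'M[R]_n) (B : 'M[R]_(n, l)) : Prop :=
  exists F : 'M[R]_(l, n), schur_stable (A + B *m F).

Definition detectable {n p : nat} (A : 'M[R]_n) (C : 'M[R]_(p, n)) : Prop :=
  exists L : 'M[R]_(n, p), schur_stable (A + L *m C).

Definition riccati {n l : nat} (A : 'M[R]_n) (B : 'M[R]_(n, l))
    (Qw : 'M[R]_n) (Rw : 'M[R]_l) (Pm : 'M[R]_n) : Prop :=
  Pm = A^T *m Pm *m A + Qw
       - A^T *m Pm *m B *m invmx (Rw + B^T *m Pm *m B) *m B^T *m Pm *m A.

Definition gain {n l : nat} (A : 'M[R]_n) (B : 'M[R]_(n, l))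
    (Rw : 'M[R]_l) (Pm : 'M[R]_n) : 'M[R]_(l, n) :=
  - (invmx (Rw + B^T *m Pm *m B) *m B^T *m Pm *m A).

End linear_algebra.

Section random_vectors.
Context {d : measure_display} {Omega : measurableType d} {R : realType}.
Implicit Type P : probability Omega R.

(* The sigma-algebra generated by a random vector: [R^n] carries its Borel
   sigma-algebra, which is generated by the coordinates. *)
Definition sigma_rv {n : nat} (X : Omega -> 'cV[R]_n) : set (set Omega) :=
  g_sigma_preimage (fun (i : 'I_n) (w : Omega) => (X w i 0 : measurableTypeR R)).

Definition filtration {n : nat} (X : nat -> Omega -> 'cV[R]_n) (k : nat) :
    set (set Omega) :=
  <<s \bigcup_(i in `I_k.+1) sigma_rv (X i) >>.

Definition indep_rv P {n p : nat} (X : Omega -> 'cV[R]_n)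
    (Y : Omega -> 'cV[R]_p) : Prop :=
  forall E F, sigma_rv X E -> sigma_rv Y F -> P (E `&` F) = (P E * P F)%E.

Definition mutually_indep P {n : nat} (X : nat -> Omega -> 'cV[R]_n) : Prop :=
  forall (J : seq nat) (E : nat -> set Omega), uniq J ->
    (forall j, j \in J -> sigma_rv (X j) (E j)) ->
    P (\bigcap_(j in [set` J]) E j) = (\prod_(j <- J) P (E j))%E.

Definition L2 P (F : set (set Omega)) {n : nat} (X : Omega -> 'cV[R]_n) : Prop :=
  sigma_rv X `<=` F /\
  forall i : 'I_n, (fun w => X w i 0) \in Lfun P 2%:E.

(* The possibly degenerate normal law with mean m and variance v.
   [normal_prob] takes the standard deviation, and is not a Dirac mass when
   the latter is 0. *)
Definition normal_law (m v : R) (E : set (measurableTypeR R)) : \bar R :=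
  if v == 0 then dirac m E else normal_prob m (Num.sqrt v) E.

(* X ~ N(mu, Sigma): every linear functional of X is normally distributed.
   [Sigma] may be singular. *)
Definition gaussian P {n : nat} (mu : 'cV[R]_n) (Sigma : 'M[R]_n)
    (X : Omega -> 'cV[R]_n) : Prop :=
  [/\ psd Sigma,
      forall i : 'I_n, measurable_fun setT (fun w => X w i 0) &
      forall (a : 'cV[R]_n) (E : set (measurableTypeR R)), measurable E ->
        P ((fun w => (a^T *m X w) 0 0) @^-1` E) =
        normal_law ((a^T *m mu) 0 0) (qform Sigma a) E].

Definition iid_noise P {n : nat} (SigmaW : 'M[R]_n)
    (W : nat -> Omega -> 'cV[R]_n) : Prop :=
  (forall k, gaussian P 0 SigmaW (W k)) /\ mutually_indep P W.

End random_vectors.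

Section control.
Context {d : measure_display} {Omega : measurableType d} {R : realType}.
Implicit Type P : probability Omega R.
Context {n l : nat}.
Implicit Types (A : 'M[R]_n) (B : 'M[R]_(n, l)) (W : nat -> Omega -> 'cV[R]_n).
Implicit Type U : nat -> Omega -> 'cV[R]_l.

Fixpoint state A B W (X0 : Omega -> 'cV[R]_n) U (k : nat) : Omega -> 'cV[R]_n :=
  if k is k'.+1 then
    fun w => A *m state A B W X0 U k' w + B *m U k' w + W k' w
  else X0.

Definition control_process P A B W (X0 : Omega -> 'cV[R]_n) U : Prop :=
  let X := state A B W X0 U in
  [/\ forall k, L2 P (filtration X k) (U k),
      forall k, L2 P (filtration X k) (X k) &
      forall k, indep_rv P (W k) (fun w => col_mx (X k w) (U k w))].

Definition stage_cost P (Qw : 'M[R]_n) (Rw : 'M[R]_l)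
    (X : Omega -> 'cV[R]_n) (U : Omega -> 'cV[R]_l) : \bar R :=
  'E_P[fun w => qform Qw (X w) + qform Rw (U w)].

Definition cost P A B W Qw Rw (N : nat) (X0 : Omega -> 'cV[R]_n) U : \bar R :=
  (\sum_(k < N) stage_cost P Qw Rw (state A B W X0 U k) (U k))%E.

Definition stationary_pair P A B W (K : 'M[R]_(l, n)) (Sigmas : 'M[R]_n)
    (Xs : nat -> Omega -> 'cV[R]_n) (Us : nat -> Omega -> 'cV[R]_l) : Prop :=
  [/\ gaussian P 0 Sigmas (Xs 0%N),
      forall k w, Us k w = K *m Xs k w,
      forall k w, Xs k.+1 w = (A + B *m K) *m Xs k w + W k w &
      forall k, indep_rv P (W k) (fun w => col_mx (Xs k w) (Us k w))].

Definition distance P (H : 'M[R]_(n + l)) (X Xs : Omega -> 'cV[R]_n)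
    (U Us : Omega -> 'cV[R]_l) : \bar R :=
  'E_P[fun w => qform H (col_mx (X w - Xs w) (U w - Us w))].

Definition storage P (Pm S : 'M[R]_n) (Xs : nat -> Omega -> 'cV[R]_n)
    (k : nat) (X : Omega -> 'cV[R]_n) : \bar R :=
  (- 'E_P[fun w => (qform Pm (X w) - qform Pm (X w - Xs k w))%R]
   + 'E_P[fun w => qform S (X w - Xs k w)])%E.

Definition dissipativity_identity P A B W Qw Rw Pm
    (mu0 : 'cV[R]_n) (Sigma0 : 'M[R]_n)
    (Xs : nat -> Omega -> 'cV[R]_n) (Us : nat -> Omega -> 'cV[R]_l)
    (S : 'M[R]_n) (H : 'M[R]_(n + l)) : Prop :=
  forall X0 U, gaussian P mu0 Sigma0 X0 -> control_process P A B W X0 U ->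
  let X := state A B W X0 U in
  forall k,
    (stage_cost P Qw Rw (X k) (U k) - stage_cost P Qw Rw (Xs k) (Us k)
     + storage P Pm S Xs k (X k) - storage P Pm S Xs k.+1 (X k.+1))%E
    = distance P H (X k) (Xs k) (U k) (Us k).

Definition close_times P (H : 'M[R]_(n + l))
    (X Xs : nat -> Omega -> 'cV[R]_n) (U Us : nat -> Omega -> 'cV[R]_l)
    (N : nat) (eps : R) : nat :=
  #|[pred k : 'I_N | (distance P H (X k) (Xs k) (U k) (Us k) <= eps%:E)%E]|.

End control.

(* Main.v *)
(* Summing the dissipativity identity over k < N telescopes the storage terms,
   so the distances add up to at most delta + lambda(0, X0) - lambda(N, X(N)).
   Completing the square with respect to S gives
   - lambda(N, X(N)) <= E[|Xs(N)|_M^2] with M = P + P S^-1 P, a bound that does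
   not depend on the control. It does not depend on N either: Xs(N) is
   square integrable and the second moment of a^T Xs(k) is the same for all k,
   because it is proportional to a^T Sigmas a at time 0 (normal law), and the
   Lyapunov equation propagates this, the cross term vanishing since W(k) is
   centered and independent of Xs(k). Since the distances are nonnegative,
   at most (delta + C) / eps of them exceed eps. *)

Require Import Defs.
From HB Require Import structures.
From mathcomp Require Import all_boot all_order all_algebra.
From mathcomp Require Import all_classical all_reals all_analysis.
From mathcomp Require Import measurable_realfun ring lra.

Set Implicit Arguments.
Unset Strict Implicit.
Unset Printing Implicit Defensive.

Import Order.TTheory GRing.Theory Num.Theory.
Import numFieldNormedType.Exports.

Local Open Scope classical_set_scope.
Local Open Scope ring_scope.

(** * Second moments of the normal distribution on the line *)

Section normal_moments.
Context {R : realType}.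
Local Notation mu := (@lebesgue_measure R).

(** The Radon-Nikodym derivative of [normal_prob] and [normal_pdf] integrate to the same value over
    every measurable set, so they agree almost everywhere. *)
Lemma ge0_integral_normal_prob (m s : R) (f : R -> \bar R) :
  (forall x, 0 <= f x)%E -> measurable_fun setT f ->
  (\int[normal_prob m s]_x f x = \int[mu]_x (f x * (normal_pdf m s x)%:E))%E.
Proof.
move=> f0 mf.
have dom := normal_prob_dominates m s.
rewrite -(Radon_Nikodym_SigmaFinite.change_of_variables dom)//.
apply: ae_eq_integral => //.
- apply: emeasurable_funM => //.
  exact: measurable_int (Radon_Nikodym_SigmaFinite.f_integrable dom).
- apply: emeasurable_funM => //; apply/measurable_EFinP.
  exact: measurable_normal_pdf.
- apply: ae_eqe_mul2l.
  apply: integral_ae_eq => //.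
  + exact: Radon_Nikodym_SigmaFinite.f_integrable.
  + by apply/measurable_EFinP; exact: measurable_normal_pdf.
  + by move=> E _ mE; rewrite -Radon_Nikodym_SigmaFinite.f_integral.
Qed.

Lemma normal_pdf_scale (s x : R) : 0 < s ->
  normal_pdf 0 s x = normal_pdf 0 1 (x / s) / s.
Proof.
move=> s0; rewrite !normal_pdfE ?gt_eqF// /normal_peak /normal_fun.
rewrite !subr0 expr1n mul1r -mulrnAr sqrtrM ?sqr_ge0// sqrtr_sqr gtr0_norm//.
have -> : - x ^+ 2 / (s ^+ 2 *+ 2) = - (x / s) ^+ 2 / (1 *+ 2).
  by field; rewrite gt_eqF.
by rewrite invfM -mulrA [RHS]mulrC.
Qed.

Lemma normal_prob_second_moment (s : R) : 0 < s ->
  (\int[normal_prob 0 s]_x (x ^+ 2)%:E =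
   (s ^+ 2)%:E * \int[normal_prob 0 1]_x (x ^+ 2)%:E)%E.
Proof.
move=> s0.
have mX2 : measurable_fun setT (fun x : R => (x ^+ 2)%:E).
  by apply/measurable_EFinP; exact: measurable_funX.
have X20 (x : R) : (0 <= (x ^+ 2)%:E)%E by rewrite lee_fin sqr_ge0.
rewrite !ge0_integral_normal_prob//.
have dF : (fun x : R^o => x / s)^`()%classic = cst s^-1.
  by apply/funext => x; rewrite derive1E deriveM// derive_cst scaler0 add0r
    derive_id scaler1.
under [in RHS]eq_integral do rewrite -EFinM.
(* The standard integral on the right is turned into an integral in x by the substitution y = x / s;
   the Jacobian 1 / s is absorbed by [normal_pdf_scale]. *)
rewrite (@increasing_ge0_integration_by_substitutionT R (fun x => x / s)
  (fun x => x ^+ 2 * normal_pdf 0 1 x)); first last.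
- by move=> x; rewrite mulr_ge0 ?sqr_ge0// normal_pdf_ge0.
- move=> x; apply: cvgM; first exact: sqr_continuous.
  by apply: continuous_normal_pdf; rewrite oner_eq0.
- by apply/gt0_cvgMly; [rewrite invr_gt0|exact: cvg_id].
- by apply/gt0_cvgMlNy; [rewrite invr_gt0|exact: cvg_id].
- by move=> x; exact: derivableM.
- by rewrite dF; exact: is_cvg_cst.
- by rewrite dF; exact: is_cvg_cst.
- by rewrite dF => ?; exact: cvg_cst.
- by move=> x y xy; rewrite ltr_pM2r// invr_gt0.
rewrite dF -ge0_integralZl//=; first last.
- move=> x _; rewrite lee_fin; apply: mulr_ge0; last by rewrite /= invr_ge0 ltW.
  by apply: mulr_ge0; rewrite /= ?sqr_ge0 ?normal_pdf_ge0.
- apply/measurable_EFinP.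
  apply: measurable_funM => //; apply: measurable_funM => //=.
    by apply: measurable_funX; exact: measurable_funM.
  by apply: measurableT_comp;
    [exact: measurable_normal_pdf|exact: measurable_funM].
apply: eq_integral => x _; rewrite normal_pdf_scale// -!EFinM; congr EFin.
rewrite -[RHS]/(s ^+ 2 * ((x / s) ^+ 2 * normal_pdf 0 1 (x / s) / s)).
by field; rewrite gt_eqF.
Qed.

(** The integrand is dominated by a multiple of the normal density of variance 2, because x^2
    e^(-x^2/2) <= 4 e^(-x^2/4). *)
Lemma std_normal_second_moment_lty :
  (\int[normal_prob 0 1]_x ((x : R) ^+ 2)%:E < +oo)%E.
Proof.
have mX2 : measurable_fun setT (fun x : R => (x ^+ 2)%:E).
  by apply/measurable_EFinP; exact: measurable_funX.
rewrite ge0_integral_normal_prob//; last by move=> x; rewrite lee_fin sqr_ge0.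
pose s : R := Num.sqrt 2.
have s0 : s != 0 by rewrite gt_eqF// sqrtr_gt0.
(* The quotient exchanges the normalizing factors of the two densities; the 4 comes from writing x^2
   = 4 t. *)
pose c : R := 4 * normal_peak 1 / normal_peak s.
have c0 : 0 <= c by rewrite !mulr_ge0 ?invr_ge0 ?normal_peak_ge0.
apply: (@le_lt_trans _ _ (\int[mu]_x (c%:E * (normal_pdf 0 s x)%:E))%E).
  apply: ge0_le_integral => //.
  - by move=> x _; rewrite mule_ge0// lee_fin ?sqr_ge0 ?normal_pdf_ge0.
  - apply: emeasurable_funM => //; apply/measurable_EFinP.
    exact: measurable_normal_pdf.
  - apply: emeasurable_funM => //; apply/measurable_EFinP.
    exact: measurable_normal_pdf.
  - move=> x _; rewrite -!EFinM lee_fin !normal_pdfE ?oner_eq0//.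
    have -> : c * (normal_peak s * normal_fun 0 s x) =
        normal_peak 1 * (4 * normal_fun 0 s x).
      by rewrite /c; field; rewrite gt_eqF ?normal_peak_gt0.
    rewrite mulrCA ler_pM2l ?normal_peak_gt0 ?oner_eq0//.
    rewrite /normal_fun !subr0 sqr_sqrtr// expr1n.
    set t := x ^+ 2 / 4.
    rewrite (_ : x ^+ 2 = 4 * t); last by rewrite /t; field.
    (* [t * e^(- 2 t) <= e^(- t)] because [t <= e^t] *)
    have -> : - (4 * t) / (1 *+ 2) = - t - t by field.
    have -> : - (4 * t) / (2 *+ 2) = - t by field.
    rewrite expRD -mulrA ler_pM2l// mulrA ger_pMl ?expR_gt0//.
    rewrite expRN ler_pdivrMr ?expR_gt0// mul1r.
    by rewrite (le_trans _ (expR_ge1Dx t))// lerDr.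
rewrite ge0_integralZl//=; first last.
- by move=> x _; rewrite lee_fin normal_pdf_ge0.
- by apply/measurable_EFinP; exact: measurable_normal_pdf.
by rewrite integral_normal_pdf mule1 ltry.
Qed.

End normal_moments.

(** * Square-integrable variables, independence and symmetry *)

Section square_integrable.
Context {d : measure_display} {Omega : measurableType d} {R : realType}.
Variable P : probability Omega R.

Lemma Lfun_measurable p (f : Omega -> R) :
  f \in Lfun P p -> measurable_fun setT f.
Proof. by rewrite inE => /andP[/[!inE]]. Qed.

Lemma Lfun2_sub_Lfun1 (f : Omega -> R) : f \in Lfun P 2%:E -> f \in Lfun P 1.
Proof. by apply: Lfun_subset12; rewrite fin_num_measure. Qed.

Lemma Lfun2_sqr_lty (f : Omega -> R) : measurable_fun setT f ->
  (\int[P]_w (f w ^+ 2)%:E < +oo)%E -> f \in Lfun P 2%:E.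
Proof.
move=> mf f2; rewrite inE; apply/andP; split; rewrite inE//=.
rewrite /finite_norm unlock poweR_lty//.
rewrite (le_lt_trans _ f2)//.
under eq_integral do rewrite /= powR_mulrn// real_normK ?num_real//.
by [].
Qed.

Lemma expectation_Rintegral (f : Omega -> R) :
  f \in Lfun P 1 -> 'E_P[f]%E = (\int[P]_w f w)%:E.
Proof.
move=> f1; rewrite /Rintegral fineK.
  by rewrite unlock.
by have := expectation_fin_num f1; rewrite unlock.
Qed.

(** Independence on rectangles identifies the joint law with the product of the marginals, by
    uniqueness of the product measure; Fubini then splits the integral. *)
Lemma expectation_mul_indep (X Y : {RV P >-> R}) :
  (X : Omega -> R) \in Lfun P 2%:E -> (Y : Omega -> R) \in Lfun P 2%:E ->
  (forall E F : set R, measurable E -> measurable F ->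
    P (X @^-1` E `&` Y @^-1` F) = (P (X @^-1` E) * P (Y @^-1` F))%E) ->
  \int[P]_w (X w * Y w) = (\int[P]_w X w) * (\int[P]_w Y w).
Proof.
move=> X2 Y2 XY.
have iX := (Lfun1_integrable _ _).1 (Lfun2_sub_Lfun1 X2).
have iY := (Lfun1_integrable _ _).1 (Lfun2_sub_Lfun1 Y2).
have iXY := (Lfun1_integrable _ _).1 (Lfun2_mul_Lfun1 X2 Y2).
have mZ : measurable_fun setT (fun w => (X w, Y w)).
  exact: measurable_fun_pair.
pose Z : {RV P >-> (R * R)%type} := mfun_Sub (mem_set mZ).
pose m1 := distribution P X; pose m2 := distribution P Y.
have XYE (S : set (R * R)) :
    measurable S -> (m1 \x m2)%E S = distribution P Z S.
  by move=> mS; apply: product_measure_unique => // E F mE mF; exact: XY.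
pose f (z : R * R) : \bar R := (z.1 * z.2)%:E.
have mf : measurable_fun setT f.
  by apply/measurable_EFinP; exact: measurable_funM.
have iZ : (distribution P Z).-integrable setT f.
  exact: integrable_pushforward.
(* Fubini needs integrability under the product law; it is carried over from the joint law, where it
   says that [X * Y] is in L^1. *)
have im : (m1 \x m2)%E.-integrable setT f.
  apply/integrableP; split => //; case/integrableP: iZ => _; apply: le_lt_trans.
  rewrite le_eqVlt; apply/orP; left; apply/eqP.
  by apply: eq_measure_integral => S mS _; exact: XYE.
rewrite /Rintegral -fineM; [|exact: integrable_fin_num..].
congr fine.
transitivity (\int[distribution P Z]_z f z)%E.
  by rewrite integral_distribution.
transitivity (\int[m1 \x m2]_z f z)%E.
  by apply: eq_measure_integral => S mS _; exact/esym/XYE.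
rewrite -integral12_prod_meas1//.
have iEX : m1.-integrable setT (EFin : R -> \bar R).
  exact: integrable_pushforward.
have iEY : m2.-integrable setT (EFin : R -> \bar R).
  exact: integrable_pushforward.
have -> : fubini_F m2 f = fun x => (x%:E * (\int[P]_w Y w)%:E)%E.
  apply/funext => x; rewrite /fubini_F /f/=.
  transitivity (\int[m2]_y (x%:E * y%:E))%E; first by [].
  rewrite integralZl// integral_distribution// /Rintegral fineK//.
  exact: integrable_fin_num.
rewrite integralZr// integral_distribution// /Rintegral fineK//.
exact: integrable_fin_num.
Qed.

(** X and -X have the same law, so the mean equals its own opposite. This gives the mean of a
    centered Gaussian without integrating against the density. *)
Lemma expectation0_symmetric (X : Omega -> R) : X \in Lfun P 1 ->
  (forall E : set R, measurable E ->
    P (X @^-1` E) = P ((fun w => - X w) @^-1` E)) ->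
  \int[P]_w X w = 0.
Proof.
move=> X1 XN.
have mX := Lfun_measurable X1.
have iX := (Lfun1_integrable _ _).1 X1.
have mNX : measurable_fun setT (fun w => - X w) by exact: measurable_funN.
have iNX : P.-integrable setT (EFin \o (fun w => - X w)).
  exact: integrableN iX.
suff h : (\int[P]_w (X w)%:E = \int[P]_w (- X w)%:E)%E.
  have : \int[P]_w X w = - (\int[P]_w X w).
    rewrite {1}/Rintegral h.
    under eq_integral do rewrite -mulN1r.
    by rewrite -/(Rintegral _ _ _) RintegralZl// mulN1r.
  by move/eqP; rewrite -addr_eq0 -mulr2n mulrn_eq0/= => /eqP.
have mE : measurable_fun setT (EFin : R -> \bar R) by [].
pose XR : {RV P >-> R} := mfun_Sub (mem_set mX).
pose NXR : {RV P >-> R} := mfun_Sub (mem_set mNX).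
transitivity (\int[distribution P XR]_x x%:E)%E.
  by rewrite integral_distribution.
transitivity (\int[distribution P NXR]_x x%:E)%E;
  last by rewrite integral_distribution.
by apply: eq_measure_integral => E mE' _; exact: XN.
Qed.

End square_integrable.

(** * Centered normal variables, degenerate ones included *)

Section normal_variables.
Context {d : measure_display} {Omega : measurableType d} {R : realType}.
Variable P : probability Omega R.

(* Its value is 1, but only its finiteness is needed: it is a common factor of
   the second moments of the noise and of the stationary state. *)
Definition std_normal_second_moment : R :=
  fine (\int[normal_prob 0 1]_x ((x : R) ^+ 2)%:E)%E.

(** The integral depends only on the law of Y: a Dirac mass at 0 if v = 0, otherwise a rescaled
    standard normal with s = sqrt v. Both cases fit one formula linear in v. *)
Lemma centered_normal_second_moment (Y : Omega -> R) (v : R) :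
  measurable_fun setT Y -> 0 <= v ->
  (forall E : set (measurableTypeR R), measurable E ->
    P (Y @^-1` E) = normal_law 0 v E) ->
  (\int[P]_w (Y w ^+ 2)%:E)%E = (std_normal_second_moment * v)%:E.
Proof.
move=> mY v0 YE.
have mX2 : measurable_fun setT (fun x : R => (x ^+ 2)%:E).
  by apply/measurable_EFinP; exact: measurable_funX.
have X20 (x : R) : (0 <= (x ^+ 2)%:E)%E by rewrite lee_fin sqr_ge0.
have mY' : @measurable_fun _ _ Omega (measurableTypeR R) setT Y by exact: mY.
pose Y' : {RV P >-> measurableTypeR R} :=
  @mfun_Sub _ _ Omega (measurableTypeR R) Y (mem_set mY').
transitivity (\int[distribution P Y']_x (x ^+ 2)%:E)%E.
  by rewrite ge0_integral_distribution.
have [v_eq0|v_neq0] := eqVneq v 0.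
  rewrite v_eq0 mulr0.
  transitivity (\int[dirac (0%R : measurableTypeR R)]_x (x ^+ 2)%:E)%E.
    apply: eq_measure_integral => E mE _.
    by rewrite -[LHS]/(P (Y @^-1` E)) YE// /normal_law v_eq0 eqxx.
  by rewrite integral_dirac// diracT mul1e expr0n.
transitivity (\int[normal_prob 0 (Num.sqrt v)]_x (x ^+ 2)%:E)%E.
  apply: eq_measure_integral => E mE _.
  by rewrite -[LHS]/(P (Y @^-1` E)) YE// /normal_law (negbTE v_neq0).
rewrite normal_prob_second_moment ?sqrtr_gt0 ?lt0r ?v_neq0// sqr_sqrtr//.
rewrite muleC EFinM /std_normal_second_moment fineK// ge0_fin_numE.
  exact: std_normal_second_moment_lty.
exact: integral_ge0.
Qed.

End normal_variables.

(** * Random vectors: bilinear forms, independence, Gaussian moments *)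

Section random_vectors.
Context {d : measure_display} {Omega : measurableType d} {R : realType}.
Variable P : probability Omega R.

Definition square_integrable {n} (X : Omega -> 'cV[R]_n) : Prop :=
  forall i, (fun w => X w i 0) \in Lfun P 2%:E.

Lemma Lfun_sum p (p1 : (1 <= p)%E) (I : Type) (s : seq I)
    (f : I -> Omega -> R) :
  (forall i, f i \in Lfun P p) -> (fun w => \sum_(i <- s) f i w) \in Lfun P p.
Proof.
move=> fp; rewrite (_ : (fun w => _) = \sum_(i <- s) f i).
  by apply: rpred_sum => i _; exact: fp.
by apply/funext => w; rewrite fct_sumE.
Qed.

Lemma Rintegral_sum (I : Type) (s : seq I) (f : I -> Omega -> R) :
  (forall i, f i \in Lfun P 1) ->
  \int[P]_w (\sum_(i <- s) f i w) = \sum_(i <- s) \int[P]_w f i w.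
Proof.
move=> f1; elim: s => [|i s IHs].
  under eq_Rintegral do rewrite big_nil.
  by rewrite big_nil Rintegral_cst// mul0r.
under eq_Rintegral do rewrite big_cons.
rewrite big_cons RintegralD// ?IHs//.
- exact/Lfun1_integrable.
- by apply/Lfun1_integrable; exact: Lfun_sum.
Qed.

Let le1_2 : (1 <= 2%:E :> \bar R)%E := lee1n 2.

Lemma Lfun2D (f g : Omega -> R) : f \in Lfun P 2%:E -> g \in Lfun P 2%:E ->
  (fun w => f w + g w) \in Lfun P 2%:E.
Proof. by move=> f2 g2; rewrite -[fun w => _]/(f + g) rpredD. Qed.

Lemma Lfun2B (f g : Omega -> R) : f \in Lfun P 2%:E -> g \in Lfun P 2%:E ->
  (fun w => f w - g w) \in Lfun P 2%:E.
Proof. by move=> f2 g2; rewrite -[fun w => _]/(f - g) rpredB. Qed.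

Lemma square_integrableD n (X Y : Omega -> 'cV[R]_n) :
  square_integrable X -> square_integrable Y ->
  square_integrable (fun w => X w + Y w).
Proof.
move=> X2 Y2 i; under eq_fun do rewrite mxE.
exact: (@Lfun2D (fun w => X w i 0) (fun w => Y w i 0)).
Qed.

Lemma square_integrableM n p (M : 'M[R]_(p, n)) (X : Omega -> 'cV[R]_n) :
  square_integrable X -> square_integrable (fun w => M *m X w).
Proof.
move=> X2 i; under eq_fun do rewrite mxE.
apply: Lfun_sum => // j; under eq_fun do rewrite mulrC.
by apply: Lfun_scale => //; exact: X2.
Qed.

Lemma square_integrableB n (X Y : Omega -> 'cV[R]_n) :
  square_integrable X -> square_integrable Y ->
  square_integrable (fun w => X w - Y w).
Proof.
move=> X2 Y2 i; under eq_fun do rewrite !mxE.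
exact: (@Lfun2B (fun w => X w i 0) (fun w => Y w i 0)).
Qed.

Lemma square_integrable_col n p (X : Omega -> 'cV[R]_n)
    (Y : Omega -> 'cV[R]_p) :
  square_integrable X -> square_integrable Y ->
  square_integrable (fun w => col_mx (X w) (Y w)).
Proof.
move=> X2 Y2 i; have [j ->|j ->] := split_ordP i.
  by under eq_fun do rewrite col_mxEu; exact: X2.
by under eq_fun do rewrite col_mxEd; exact: Y2.
Qed.

Lemma bilinearE n p (M : 'M[R]_(n, p)) (x : 'cV[R]_n) (y : 'cV[R]_p) :
  (x^T *m M *m y) 0 0 = \sum_i \sum_j M i j * (x i 0 * y j 0).
Proof.
rewrite -mulmxA mxE; apply: eq_bigr => i _.
rewrite !mxE mulr_sumr; apply: eq_bigr => j _; by ring.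
Qed.

Lemma Lfun1_bilinear_coef n p (c : R) (X : Omega -> 'cV[R]_n)
    (Y : Omega -> 'cV[R]_p) i j :
  square_integrable X -> square_integrable Y ->
  (fun w => c * (X w i 0 * Y w j 0)) \in Lfun P 1.
Proof.
move=> X2 Y2; under eq_fun do rewrite mulrC.
by apply: Lfun_scale => //; apply: Lfun2_mul_Lfun1; [exact: X2|exact: Y2].
Qed.

Lemma Lfun1_bilinear n p (M : 'M[R]_(n, p)) (X : Omega -> 'cV[R]_n)
    (Y : Omega -> 'cV[R]_p) :
  square_integrable X -> square_integrable Y ->
  (fun w => ((X w)^T *m M *m Y w) 0 0) \in Lfun P 1.
Proof.
move=> X2 Y2; under eq_fun do rewrite bilinearE.
by apply: Lfun_sum => // i; apply: Lfun_sum => // j; exact: Lfun1_bilinear_coef.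
Qed.

Lemma Rintegral_bilinear n p (M : 'M[R]_(n, p)) (X : Omega -> 'cV[R]_n)
    (Y : Omega -> 'cV[R]_p) :
  square_integrable X -> square_integrable Y ->
  \int[P]_w (((X w)^T *m M *m Y w) 0 0) =
  \sum_i \sum_j M i j * \int[P]_w (X w i 0 * Y w j 0).
Proof.
move=> X2 Y2; under eq_Rintegral do rewrite bilinearE.
rewrite Rintegral_sum; last first.
  by move=> i; apply: Lfun_sum => // j; exact: Lfun1_bilinear_coef.
apply: eq_bigr => i _; rewrite Rintegral_sum; last first.
  by move=> j; exact: Lfun1_bilinear_coef.
apply: eq_bigr => j _; rewrite RintegralZl//.
by apply/Lfun1_integrable/Lfun2_mul_Lfun1; [exact: X2|exact: Y2].
Qed.

Lemma linear_mulE n p (a x : 'cV[R]_n) (b y : 'cV[R]_p) :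
  (a^T *m x) 0 0 * (b^T *m y) 0 0 = (x^T *m (a *m b^T) *m y) 0 0.
Proof.
have <- : (x^T *m a) 0 0 = (a^T *m x) 0 0.
  by rewrite -[in LHS](trmxK a) -trmx_mul mxE.
by rewrite (mulmxA x^T) -mulmxA [RHS]mxE big_ord1.
Qed.

Lemma sqr_linearE n (a x : 'cV[R]_n) :
  ((a^T *m x) 0 0) ^+ 2 = (x^T *m (a *m a^T) *m x) 0 0.
Proof. by rewrite expr2 linear_mulE. Qed.

(** Polarization: 4 Z_i Z_j is the difference of the squares of Z along e_i + e_j and e_i - e_j, so
    second moments in all directions determine every E[Z_i Z_j]. *)
Lemma eq_Rintegral_qform n (M : 'M[R]_n) (X Y : Omega -> 'cV[R]_n) :
  square_integrable X -> square_integrable Y ->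
  (forall a : 'cV[R]_n, \int[P]_w (((a^T *m X w) 0 0) ^+ 2) =
    \int[P]_w (((a^T *m Y w) 0 0) ^+ 2)) ->
  \int[P]_w qform M (X w) = \int[P]_w qform M (Y w).
Proof.
move=> X2 Y2 XY; rewrite !Rintegral_bilinear//.
apply: eq_bigr => i _; apply: eq_bigr => j _; congr (_ * _).
pose e (k : 'I_n) : 'cV[R]_n := delta_mx k 0.
have polar (Z : Omega -> 'cV[R]_n) : square_integrable Z ->
  4 * \int[P]_w (Z w i 0 * Z w j 0) =
  \int[P]_w ((((e i + e j)^T *m Z w) 0 0) ^+ 2) -
  \int[P]_w ((((e i - e j)^T *m Z w) 0 0) ^+ 2).
  move=> Z2.
  have iZ (a : 'cV[R]_n) : P.-integrable setT
      (EFin \o (fun w => ((a^T *m Z w) 0 0) ^+ 2)).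
    apply/Lfun1_integrable; under eq_fun do rewrite sqr_linearE.
    exact: Lfun1_bilinear.
  rewrite -RintegralB//; [|exact: iZ..].
  transitivity (\int[P]_w (4 * (Z w i 0 * Z w j 0))).
    rewrite RintegralZl//.
    by apply/Lfun1_integrable/Lfun2_mul_Lfun1; exact: Z2.
  apply: eq_Rintegral => w _; rewrite !linearD/= linearN/= /e !trmx_delta.
  by rewrite mulmxDl mulmxBl -!rowE !mxE; ring.
have four0 : (4 : R) != 0 by rewrite pnatr_eq0.
by apply: (mulfI four0); rewrite !polar// !XY.
Qed.

Lemma sigma_rv_coord n (X : Omega -> 'cV[R]_n) (i : 'I_n)
    (E : set (measurableTypeR R)) :
  measurable E -> sigma_rv X ((fun w => X w i 0) @^-1` E).
Proof.
move=> mE; apply: sub_sigma_algebra.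
by rewrite (bigD1 i)//=; left; exists E => //; rewrite setTI.
Qed.

(** Events about one coordinate lie in the sigma-algebra generated by the vector, so coordinates
    inherit independence. *)
Lemma indep_rv_Rintegral_mul n p (X : Omega -> 'cV[R]_n) (Y : Omega -> 'cV[R]_p)
    i j :
  square_integrable X -> square_integrable Y -> indep_rv P X Y ->
  \int[P]_w (X w i 0 * Y w j 0) = (\int[P]_w X w i 0) * (\int[P]_w Y w j 0).
Proof.
move=> X2 Y2 XY.
have mX := Lfun_measurable (X2 i); have mY := Lfun_measurable (Y2 j).
pose X' : {RV P >-> R} := mfun_Sub (mem_set mX).
pose Y' : {RV P >-> R} := mfun_Sub (mem_set mY).
apply: (@expectation_mul_indep _ _ _ P X' Y') => //; [exact: X2|exact: Y2|].
by move=> E F mE mF; apply: XY; exact: sigma_rv_coord.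
Qed.

Lemma qformN n (M : 'M[R]_n) (x : 'cV[R]_n) : qform M (- x) = qform M x.
Proof. by rewrite /qform mulmxN [(- x)^T]linearN/= !mulNmx opprK. Qed.

Section centered_gaussian.
Variables (n : nat) (Sigma : 'M[R]_n) (X : Omega -> 'cV[R]_n).
Hypothesis gX : gaussian P 0 Sigma X.

Lemma gaussian_measurable_linear (a : 'cV[R]_n) :
  measurable_fun setT (fun w => (a^T *m X w) 0 0).
Proof.
case: gX => _ mX _; under eq_fun do rewrite mxE.
by apply: measurable_sum => i; apply: measurable_funM => //; exact: mX.
Qed.

Lemma gaussian_integral_sqr (a : 'cV[R]_n) :
  (\int[P]_w (((a^T *m X w) 0 0) ^+ 2)%:E)%E =
  (std_normal_second_moment * qform Sigma a)%:E.
Proof.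
case: gX => -[_ Sigma0] _ XE.
apply: centered_normal_second_moment => //.
  exact: gaussian_measurable_linear.
by move=> E mE; rewrite XE// mulmx0 mxE.
Qed.

Lemma gaussian_Rintegral_sqr (a : 'cV[R]_n) :
  \int[P]_w (((a^T *m X w) 0 0) ^+ 2) =
  std_normal_second_moment * qform Sigma a.
Proof. by rewrite /Rintegral gaussian_integral_sqr. Qed.

Let e (i : 'I_n) : 'cV[R]_n := delta_mx i 0.

Let coordE (w : Omega) i : X w i 0 = ((e i)^T *m X w) 0 0.
Proof. by rewrite /e trmx_delta -rowE mxE. Qed.

Lemma gaussian_square_integrable : square_integrable X.
Proof.
move=> i; under eq_fun do rewrite coordE.
apply: Lfun2_sqr_lty; first exact: gaussian_measurable_linear.
by rewrite gaussian_integral_sqr ltry.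
Qed.

(** The functionals given by e_i and -e_i both have mean 0 and the same variance, hence the same
    law; the coordinate is symmetric. *)
Lemma gaussian_Rintegral0 i : \int[P]_w X w i 0 = 0.
Proof.
apply: expectation0_symmetric.
  exact/Lfun2_sub_Lfun1/gaussian_square_integrable.
move=> E mE; have [_ _ XE] := gX.
have cE : (fun w => X w i 0) = (fun w => ((e i)^T *m X w) 0 0).
  by apply/funext => w; exact: coordE.
have nE : (fun w => - X w i 0) = (fun w => ((- e i)^T *m X w) 0 0).
  by apply/funext => w; rewrite [(- _)^T]linearN/= mulNmx mxE coordE.
by rewrite nE cE (XE (e i) E mE) (XE (- e i) E mE) !mulmx0 qformN.
Qed.

End centered_gaussian.

End random_vectors.

(** * Positive definite forms and completing the square *)

Section quadratic_forms.
Context {R : realType}.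

Lemma posdef_ge0 n (S : 'M[R]_n) (x : 'cV[R]_n) : posdef S -> 0 <= qform S x.
Proof.
case=> _ S0; have [->|x0] := eqVneq x 0; last exact/ltW/S0.
by rewrite /qform mulmx0 mxE.
Qed.

Lemma posdef_unitmx n (S : 'M[R]_n) : posdef S -> S \in unitmx.
Proof.
case=> _ S0; rewrite unitmxE unitfE; apply/negP => /det0P[v v0 vS].
have /S0 : v^T != 0 by rewrite -trmx0 (inj_eq trmx_inj).
by rewrite /qform trmxK vS mul0mx mxE ltxx.
Qed.

(** The right side minus the left side is exactly [qform S (y - t)] with t = S^-1 M x, the point
    where the left side is maximal in y. *)
Lemma qform_complete_square n (M S : 'M[R]_n) (x y : 'cV[R]_n) :
  M^T = M -> posdef S ->
  qform M (y + x) - qform M y - qform S y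
    <= qform (M + M *m invmx S *m M) x.
Proof.
move=> MT pS; have [ST _] := pS; have uS := posdef_unitmx pS.
pose t := invmx S *m (M *m x).
have St : S *m t = M *m x by rewrite /t mulKVmx.
have tS : t^T *m S = x^T *m M by rewrite -{1}ST -trmx_mul St trmx_mul MT.
have := posdef_ge0 (y - t) pS.
have -> : qform S (y - t) = qform S y - (y^T *m M *m x) 0 0 -
    (x^T *m M *m y) 0 0 + (x^T *m M *m t) 0 0.
  rewrite /qform [(y - t)^T]linearB/= mulmxBl tS !mulmxBr !mulmxBl.
  rewrite -(mulmxA y^T S t) St mulmxA; move: (y^T *m S *m y) => u.
  by rewrite !mxE; ring.
have -> : qform M (y + x) = qform M y + (y^T *m M *m x) 0 0 +
    (x^T *m M *m y) 0 0 + qform M x.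
  by rewrite /qform [(y + x)^T]linearD/= mulmxDl !mulmxDr !mulmxDl !mxE; ring.
have -> : qform (M + M *m invmx S *m M) x = qform M x + (x^T *m M *m t) 0 0.
  by rewrite /qform mulmxDr mulmxDl mxE /t !mulmxA.
lra.
Qed.

End quadratic_forms.

(** * Propagation of second moments along the stationary process *)

Section stationary_moments.
Context {d : measure_display} {Omega : measurableType d} {R : realType}.
Variable P : probability Omega R.

(** With b = F^T a the square expands into two squares and a cross term 2 (b^T X)(a^T W), a bilinear
    form in X and W whose expectation vanishes coefficient by coefficient. *)
Lemma Rintegral_sqr_linear_step n (F : 'M[R]_n) (X W : Omega -> 'cV[R]_n)
    (a : 'cV[R]_n) :
  square_integrable P X -> square_integrable P W ->
  (forall i j, \int[P]_w (X w i 0 * W w j 0) = 0) ->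
  \int[P]_w (((a^T *m (F *m X w + W w)) 0 0) ^+ 2) =
  \int[P]_w ((((F^T *m a)^T *m X w) 0 0) ^+ 2) +
  \int[P]_w (((a^T *m W w) 0 0) ^+ 2).
Proof.
move=> X2 W2 XW0; pose b := F^T *m a.
have isq (c : 'cV[R]_n) (Z : Omega -> 'cV[R]_n) : square_integrable P Z ->
    P.-integrable setT (EFin \o (fun w => ((c^T *m Z w) 0 0) ^+ 2)).
  move=> Z2; apply/Lfun1_integrable; under eq_fun do rewrite sqr_linearE.
  exact: Lfun1_bilinear.
have icross := (Lfun1_integrable _ _).1
  (Lfun1_bilinear (2 *: (b *m a^T)) X2 W2).
transitivity (\int[P]_w ((((b^T *m X w) 0 0) ^+ 2 +
    ((X w)^T *m (2 *: (b *m a^T)) *m W w) 0 0) + ((a^T *m W w) 0 0) ^+ 2)).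
  apply: eq_Rintegral => w _.
  have -> : a^T *m (F *m X w + W w) = b^T *m X w + a^T *m W w.
    by rewrite mulmxDr /b trmx_mul trmxK mulmxA.
  have -> : ((X w)^T *m (2 *: (b *m a^T)) *m W w) 0 0 =
      2 * ((b^T *m X w) 0 0 * (a^T *m W w) 0 0).
    by rewrite linear_mulE -scalemxAr -scalemxAl mxE.
  by rewrite mxE; ring.
have i1 : P.-integrable setT (EFin \o (fun w => ((b^T *m X w) 0 0) ^+ 2 +
    ((X w)^T *m (2 *: (b *m a^T)) *m W w) 0 0)).
  exact: integrableD (isq b X X2) icross.
rewrite RintegralD//; last exact: isq.
rewrite RintegralD//; last exact: isq.
rewrite Rintegral_bilinear// big1 ?addr0// => i _.
by rewrite big1// => j _; rewrite XW0 mulr0.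
Qed.

(** The induction carries only square integrability and the directional second moments; normality of
    [Xs k] is used at time 0 alone. *)
Lemma stationary_second_moment n l (A : 'M[R]_n) (B : 'M[R]_(n, l))
    (SigmaW Sigmas : 'M[R]_n) (W Xs : nat -> Omega -> 'cV[R]_n)
    (K : 'M[R]_(l, n)) (Us : nat -> Omega -> 'cV[R]_l) :
  (forall k, gaussian P 0 SigmaW (W k)) ->
  Sigmas = (A + B *m K) *m Sigmas *m (A + B *m K)^T + SigmaW ->
  stationary_pair P A B W K Sigmas Xs Us ->
  forall k, square_integrable P (Xs k) /\
    forall a : 'cV[R]_n, \int[P]_w (((a^T *m Xs k w) 0 0) ^+ 2) =
      std_normal_second_moment * qform Sigmas a.
Proof.
move=> gW SigmasE [gX0 UsE XsE WX]; elim=> [|k [Xk2 IHk]].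
  split; first exact: gaussian_square_integrable gX0.
  by move=> a; exact: gaussian_Rintegral_sqr gX0 a.
have Wk2 := gaussian_square_integrable (gW k).
have XsSE : Xs k.+1 = fun w => (A + B *m K) *m Xs k w + W k w.
  by apply/funext => w; rewrite XsE.
have Uk2 : square_integrable P (Us k).
  by rewrite (_ : Us k = fun w => K *m Xs k w);
    [exact: square_integrableM|apply/funext => w; rewrite UsE].
rewrite XsSE; split.
  by apply: square_integrableD => //; exact: square_integrableM.
move=> a; rewrite Rintegral_sqr_linear_step//; last first.
  (* The noise is independent of the stacked pair; [lshift l i] selects the state coordinate i in
     it, and the zero mean of the noise kills the product. *)
  move=> i j; have := indep_rv_Rintegral_mul j (lshift l i) Wk2
    (square_integrable_col Xk2 Uk2) (WX k).
  rewrite (gaussian_Rintegral0 (gW k)) mul0r => <-.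
  by apply: eq_Rintegral => w _; rewrite col_mxEu mulrC.
rewrite IHk (gaussian_Rintegral_sqr (gW k)) -mulrDr; congr (_ * _).
(* What remains is the Lyapunov equation evaluated as a quadratic form at a. *)
rewrite [in RHS]SigmasE /qform mulmxDr mulmxDl [RHS]mxE trmx_mul trmxK.
by rewrite !mulmxA.
Qed.

End stationary_moments.

(** * Finiteness of the costs and a lower bound on the storage *)

Section storage_bound.
Context {d : measure_display} {Omega : measurableType d} {R : realType}.
Variables (P : probability Omega R) (n l : nat).

Lemma storageE (Pm S : 'M[R]_n) (Xs : nat -> Omega -> 'cV[R]_n) k
    (X : Omega -> 'cV[R]_n) :
  square_integrable P X -> square_integrable P (Xs k) ->
  storage P Pm S Xs k X =
  (- (\int[P]_w (qform Pm (X w) - qform Pm (X w - Xs k w))) +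
   \int[P]_w qform S (X w - Xs k w))%:E.
Proof.
move=> X2 Xs2; have D2 := square_integrableB X2 Xs2.
rewrite /storage !expectation_Rintegral//; first exact: Lfun1_bilinear.
rewrite -[fun w => _]/((fun w => qform Pm (X w)) -
  (fun w => qform Pm (X w - Xs k w))).
by apply: rpredB => //; exact: Lfun1_bilinear.
Qed.

(** The square is completed pointwise with y = X - Xs(k) and x = Xs(k), then integrated; X
    disappears from the bound. *)
Lemma storage_ge (Pm S : 'M[R]_n) (Xs : nat -> Omega -> 'cV[R]_n) k
    (X : Omega -> 'cV[R]_n) :
  Pm^T = Pm -> posdef S ->
  square_integrable P X -> square_integrable P (Xs k) ->
  (- (\int[P]_w qform (Pm + Pm *m invmx S *m Pm) (Xs k w))%:E
     <= storage P Pm S Xs k X)%E.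
Proof.
move=> PmT pS X2 Xs2; have D2 := square_integrableB X2 Xs2.
have iq (M : 'M[R]_n) (Z : Omega -> 'cV[R]_n) : square_integrable P Z ->
    P.-integrable setT (EFin \o (fun w => qform M (Z w))).
  by move=> Z2; apply/Lfun1_integrable; exact: Lfun1_bilinear.
have iD : P.-integrable setT (EFin \o
    (fun w => qform Pm (X w) - qform Pm (X w - Xs k w))).
  exact: integrableB (iq Pm X X2) (iq Pm _ D2).
rewrite storageE// -EFinN lee_fin lerNl opprD opprK.
rewrite -RintegralB//; last exact: iq.
apply: le_Rintegral => //; [exact: integrableB iD (iq S _ D2)|exact: iq|].
move=> w _; rewrite -{1}(subrK (Xs k w) (X w)).
exact: qform_complete_square.
Qed.

Lemma stage_cost_fin_num (Qw : 'M[R]_n) (Rw : 'M[R]_l)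
    (X : Omega -> 'cV[R]_n) (U : Omega -> 'cV[R]_l) :
  square_integrable P X -> square_integrable P U ->
  stage_cost P Qw Rw X U \is a fin_num.
Proof.
move=> X2 U2; apply: expectation_fin_num.
rewrite -[fun w => _]/((fun w => qform Qw (X w)) + (fun w => qform Rw (U w))).
by apply: rpredD => //; exact: Lfun1_bilinear.
Qed.

Lemma distance_ge0 (H : 'M[R]_(n + l)) (X Xs : Omega -> 'cV[R]_n)
    (U Us : Omega -> 'cV[R]_l) :
  posdef H -> (0 <= distance P H X Xs U Us)%E.
Proof. by move=> pH; apply: expectation_ge0 => w; exact: posdef_ge0. Qed.

End storage_bound.

(** Markov's inequality for the counting measure: each index with f k > eps contributes at least eps
    to the sum, so there are at most c / eps of them. *)
Lemma card_small_terms_ge (R : realFieldType) (N : nat) (f : nat -> R)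
    (eps c : R) :
  0 < eps -> (forall k, 0 <= f k) -> \sum_(k < N) f k <= c ->
  N%:R - c / eps <= #|[pred k : 'I_N | f k <= eps]|%:R.
Proof.
move=> eps0 f0 fc; rewrite lerBlDr -lerBlDl ler_pdivlMr//.
have -> : N%:R - #|[pred k : 'I_N | f k <= eps]|%:R =
    \sum_(k < N | ~~ (f k <= eps)) 1 :> R.
  apply/eqP; rewrite subr_eq -[X in X%:R == _](card_ord N).
  rewrite -!sum1_card !natr_sum.
  by rewrite addrC (bigID (fun k : 'I_N => f k <= eps)).
apply: le_trans fc.
rewrite mulr_suml [leRHS](bigID (fun k : 'I_N => f k <= eps))/=.
apply: ler_wpDl; first by apply: sumr_ge0.
by apply: ler_sum => k; rewrite -ltNge mul1r => /ltW.
Qed.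

Theorem theorem2 (R : realType) (d : measure_display)
  (Omega : measurableType d) (P : probability Omega R) (n l : nat)
  (A : 'M[R]_n) (B : 'M[R]_(n, l)) (Qw Qh : 'M[R]_n) (Rw : 'M[R]_l)
  (hAB : stabilizable A B) (hR : posdef Rw) (hQ : psd Qw)
  (* Qh is the positive semidefinite square root of Qw *)
  (hQh : psd Qh) (hQhQ : Qh *m Qh = Qw) (hAQ : detectable A Qh)
  (SigmaW : 'M[R]_n) (W : nat -> Omega -> 'cV[R]_n)
  (hW : iid_noise P SigmaW W)
  (mu0 : 'cV[R]_n) (Sigma0 : 'M[R]_n)
  (Pm : 'M[R]_n) (hPm : psd Pm) (hric : riccati A B Qw Rw Pm)
  (K : 'M[R]_(l, n)) (hK : K = gain A B Rw Pm)
  (Sigmas : 'M[R]_n)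
  (hSigmas : Sigmas = (A + B *m K) *m Sigmas *m (A + B *m K)^T + SigmaW)
  (Xs : nat -> Omega -> 'cV[R]_n) (Us : nat -> Omega -> 'cV[R]_l)
  (hs : stationary_pair P A B W K Sigmas Xs Us)
  (S : 'M[R]_n) (H : 'M[R]_(n + l)) (hS : posdef S) (hH : posdef H)
  (hdiss : dissipativity_identity P A B W Qw Rw Pm mu0 Sigma0 Xs Us S H) :
  forall X0 : Omega -> 'cV[R]_n, gaussian P mu0 Sigma0 X0 ->
  exists C : R,
  forall delta : R, 0 < delta ->
  forall N : nat, (0 < N)%N ->
  forall U : nat -> Omega -> 'cV[R]_l, control_process P A B W X0 U ->
  (cost P A B W Qw Rw N X0 U
     <= delta%:E + \sum_(k < N) stage_cost P Qw Rw (Xs k) (Us k))%E ->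
  forall eps : R, 0 < eps ->
  N%:R - (delta + C) / eps
    <= (close_times P H (state A B W X0 U) Xs U Us N eps)%:R.
Proof.
move=> X0 gX0; have [gW _] := hW; have [pmT _] := hPm.
have [_ UsE _ _] := hs.
have stat := stationary_second_moment gW hSigmas hs.
have Xs2 k : square_integrable P (Xs k) by have [] := stat k.
have Us2 k : square_integrable P (Us k).
  by rewrite (_ : Us k = fun w => K *m Xs k w);
    [exact: square_integrableM|apply/funext => w; rewrite UsE].
pose M := Pm + Pm *m invmx S *m Pm.
have MXs k : \int[P]_w qform M (Xs k w) = \int[P]_w qform M (Xs 0%N w).
  by apply: eq_Rintegral_qform => // a; rewrite (stat k).2 (stat 0%N).2.
(* Initial storage plus the bound on minus the final storage; it is fixed before [delta], [N] and
   [U] are introduced. *)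
exists (fine (storage P Pm S Xs 0 X0) + \int[P]_w qform M (Xs 0%N w)).
move=> delta delta0 N N0 U cU costU eps eps0.
have [U2 X2 _] := cU; set X := state A B W X0 U in costU U2 X2 *.
have {}U2 k : square_integrable P (U k) by have [] := U2 k.
have {}X2 k : square_integrable P (X k) by have [] := X2 k.
(* All costs and storages are finite by square integrability, so the extended-real identity can be
   handled in R. *)
pose c k := fine (stage_cost P Qw Rw (X k) (U k)).
pose cs k := fine (stage_cost P Qw Rw (Xs k) (Us k)).
pose s k := fine (storage P Pm S Xs k (X k)).
have cE k : stage_cost P Qw Rw (X k) (U k) = (c k)%:E.
  by rewrite fineK// stage_cost_fin_num.
have csE k : stage_cost P Qw Rw (Xs k) (Us k) = (cs k)%:E.
  by rewrite fineK// stage_cost_fin_num.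
have sE k : storage P Pm S Xs k (X k) = (s k)%:E by rewrite /s storageE.
(* The left side of the dissipativity identity as a real number, hence the distance at time k. *)
pose f k := c k - cs k + s k - s k.+1.
have fE k : distance P H (X k) (Xs k) (U k) (Us k) = (f k)%:E.
  by have := hdiss X0 U gX0 cU k; rewrite -/X cE csE !sE => <-.
have f0 k : 0 <= f k by rewrite -lee_fin -fE distance_ge0.
have -> : close_times P H X Xs U Us N eps = #|[pred k : 'I_N | f k <= eps]|.
  by apply: eq_card => k; rewrite !inE fE lee_fin.
apply: card_small_terms_ge => //.
have costR : \sum_(k < N) c k <= delta + \sum_(k < N) cs k.
  move: costU; rewrite /cost.
  under eq_bigr do rewrite cE.
  under [X in (_ <= _ + X)%E]eq_bigr do rewrite csE.
  by rewrite !sumEFin -EFinD lee_fin.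
(* The bound at time N is moved to time 0 by [MXs], which removes its dependence on N. *)
have sN : - (\int[P]_w qform M (Xs 0%N w)) <= s N.
  by rewrite -(MXs N) -lee_fin -sE EFinN; exact: storage_ge.
have -> : \sum_(k < N) f k =
    \sum_(k < N) c k - \sum_(k < N) cs k + (s 0%N - s N).
  elim: (N) => [|m IHm]; first by rewrite !big_ord0 !subrr addr0.
  by rewrite !big_ord_recr/= IHm /f; ring.
(* [X 0] reduces to [X0], so the storage in the witness is [s 0]; the rest is linear arithmetic. *)
rewrite -[storage _ _ _ _ _ _]/(storage P Pm S Xs 0 (X 0%N)) -/(s 0%N).
lra.
Qed.
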